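(* Let $(R,\mathfrak m)$ be a Cohen–Macaulay local ring of dimension $d$, let $I=(a_1,\dots,a_g)$ be an ideal generated by an $R$-regular sequence with $\operatorname{ht}(I)=g\ge1$, and let $\mathcal F=\{I_n\}_{n\in\mathbb Z}$ be an $I$-admissible filtration with $I_n=R$ for $n\le 0$. Let $r\ge1$. If $H^i_J(\mathcal R'(\mathcal F))_j=0$ for all $i,j$ with $i+j=r+1$ and $0\le i\le g$, and $\operatorname{depth}G(\mathcal F)\ge g-1$, then $I^n\cap I_{n+r}=I^nI_r$ for all $n\ge0$.
   Context: An $I$-filtration is a sequence of ideals $R=I_0\supseteq I_1\supseteq\cdots$ with $I_iI_j\subseteq I_{i+j}$ and $I^n\subseteq I_n$ for all $n$; it is $I$-admissible if there is $k\in\mathbb N$ with $I_n\subseteq I^{n-k}$ for all $n$. $\mathcal R'(\mathcal F)=\bigoplus_{n\in\mathbb Z}I_nt^n\subseteq R[t,t^{-1}]$ is the extended Rees algebra of $\mathcal F$, regarded as a graded module over $\mathcal R'(I)=\bigoplus_{n\in\mathbb Z}I^nt^n$ ($I^n=R$ for $n\le0$); $J=(t^{-1},It)\mathcal R'(I)$; $H^i_J(-)_j$ is the degree-$j$ component of local cohomology with support in $J$. $G(\mathcal F)=\bigoplus_{n\ge0}I_n/I_{n+1}$. *)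

(* Defs.v *)
From HB Require Import structures.
From mathcomp Require Import all_boot all_order all_algebra.
Set Implicit Arguments. Unset Strict Implicit. Unset Printing Implicit Defensive.
Import Order.TTheory GRing.Theory Num.Theory.
Local Open Scope ring_scope.

Section CommAlg.
Variable R : comNzRingType.

Definition fullset : R -> Prop := fun _ => True.
Definition subI (I J : R -> Prop) := forall x, I x -> J x.
Definition ssubI (I J : R -> Prop) := subI I J /\ exists x, J x /\ ~ I x.

Definition is_ideal (I : R -> Prop) :=
  [/\ I 0, (forall x y, I x -> I y -> I (x + y)) & (forall r x, I x -> I (r * x))].

Definition gen_ideal (s : seq R) : R -> Prop :=
  fun x => exists c : seq R, size c = size s /\ x = \sum_(i < size s) c`_i * s`_i.

Definition prod_ideal (I J : R -> Prop) : R -> Prop :=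
  fun x => exists s : seq (R * R),
    (forall p, p \in s -> I p.1 /\ J p.2) /\ x = \sum_(p <- s) p.1 * p.2.

Fixpoint ideal_pow (I : R -> Prop) (n : nat) : R -> Prop :=
  match n with 0 => fullset | n'.+1 => prod_ideal (ideal_pow I n') I end.

Definition ideal_powz (I : R -> Prop) (z : int) : R -> Prop :=
  match z with Posz n => ideal_pow I n | Negz _ => fullset end.

Definition is_prime (P : R -> Prop) :=
  [/\ is_ideal P, ~ P 1 & forall x y, P (x * y) -> P x \/ P y].

Definition prime_chain (p : nat -> R -> Prop) (n : nat) :=
  (forall k, k <= n -> is_prime (p k))%N /\ (forall k, k < n -> ssubI (p k) (p k.+1))%N.

Definition krull_dim_eq (d : nat) :=
  (exists p, prime_chain p d) /\ ~ (exists p, prime_chain p d.+1).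

Definition height_ge (P : R -> Prop) (h : nat) :=
  exists p, prime_chain p h /\ p h = P.

Definition height_eq (I : R -> Prop) (g : nat) :=
  (forall P, is_prime P -> subI I P -> height_ge P g) /\
  (exists P, [/\ is_prime P, subI I P & ~ height_ge P g.+1]).

Definition noetherian :=
  forall I, is_ideal I -> exists s : seq R, forall x, I x <-> gen_ideal s x.

Definition local_ring (m : R -> Prop) :=
  [/\ is_ideal m, ~ m 1 & forall x, ~ m x -> exists y, x * y = 1].

Definition regular_seq (s : seq R) :=
  (forall i, i < size s -> forall z,
      gen_ideal (take i s) (z * s`_i) -> gen_ideal (take i s) z)%N /\
  ~ gen_ideal s 1.

Definition depth_eq (m : R -> Prop) (k : nat) :=
  (exists s, [/\ size s = k, forall x, x \in s -> m x & regular_seq s]) /\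
  ~ (exists s, [/\ size s = k.+1, forall x, x \in s -> m x & regular_seq s]).

Definition cohen_macaulay_local (m : R -> Prop) (d : nat) :=
  [/\ noetherian, local_ring m, krull_dim_eq d & depth_eq m d].

Definition I_filtration (I : R -> Prop) (F : int -> R -> Prop) :=
  [/\ forall n, is_ideal (F n),
      (forall n : int, n <= 0 -> forall x, F n x),
      (forall n : nat, subI (F n.+1%:Z) (F n%:Z)),
      (forall i j : nat, subI (prod_ideal (F i%:Z) (F j%:Z)) (F (i + j)%:Z)) &
      (forall n : nat, subI (ideal_pow I n) (F n%:Z))].

Definition I_admissible (I : R -> Prop) (F : int -> R -> Prop) :=
  exists k : nat, forall n : nat, subI (F n%:Z) (ideal_powz I (n%:Z - k%:Z)).

(* An element is represented by a finite coefficient list s with s`_n in I_n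
   (the degree-n component); two representatives are equal in G(F) iff
   their degree-n components agree modulo I_{n+1} for all n. *)
Definition gr_valid (F : int -> R -> Prop) (s : seq R) :=
  forall n : nat, F n%:Z s`_n.
Definition gr_eq (F : int -> R -> Prop) (s s' : seq R) :=
  forall n : nat, F n.+1%:Z (s`_n - s'`_n).
Definition gr_add (s s' : seq R) : seq R :=
  mkseq (fun n => s`_n + s'`_n) (maxn (size s) (size s')).
Definition gr_mul (s s' : seq R) : seq R :=
  mkseq (fun n => \sum_(i < n.+1) s`_i * s'`_(n - i)) (size s + size s').
Definition gr_sum (l : seq (seq R)) : seq R := foldr gr_add [::] l.

Definition gr_ideal (F : int -> R -> Prop) (ys : seq (seq R)) (z : seq R) :=
  exists cs : seq (seq R),
    [/\ size cs = size ys, (forall c, c \in cs -> gr_valid F c) &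
        gr_eq F z (gr_sum [seq gr_mul c.1 c.2 | c <- zip cs ys])].

(* the homogeneous maximal ideal m/I_1 (+) G(F)_+ *)
Definition gr_in_max (m : R -> Prop) (y : seq R) := m y`_0.

Definition gr_weak_regular (F : int -> R -> Prop) (ys : seq (seq R)) :=
  (forall i, i < size ys -> forall z, gr_valid F z ->
     gr_ideal F (take i ys) (gr_mul z (nth [::] ys i)) ->
     gr_ideal F (take i ys) z)%N.

Definition gr_depth_ge (m : R -> Prop) (F : int -> R -> Prop) (k : nat) :=
  exists ys : seq (seq R),
    [/\ size ys = k, (forall y, y \in ys -> gr_valid F y /\ gr_in_max m y) &
        gr_weak_regular F ys].

(* J = (t^{-1}, a_1 t, ..., a_g t) R'(I).  Generators are indexed by
   'I_(g+1): index 0 is t^{-1} = 1 * t^{-1}, index k >= 1 is a_k t.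
   Write each generator as x_k = gen k * t^(deg k). *)
Definition cech_gen (a : seq R) (k : 'I_(size a).+1) : R :=
  if (k == 0 :> nat) then 1 else a`_(k.-1).
Definition cech_deg (a : seq R) (k : 'I_(size a).+1) : int :=
  if (k == 0 :> nat) then -1 else 1.
(* x_S = prod_{k in S} x_k = cech_b S * t^(cech_e S) *)
Definition cech_b (a : seq R) (S : {set 'I_(size a).+1}) : R :=
  \prod_(k in S) cech_gen k.
Definition cech_e (a : seq R) (S : {set 'I_(size a).+1}) : int :=
  \sum_(k in S) cech_deg k.

(* A degree-j i-cochain of the Cech complex
     C^i = (+)_{|S| = i} R'(F)_{x_S}
   with common exponent N: its S-component is
     (c S) t^(j + N e_S) / x_S^N ,  with c S in I_(j + N e_S). *)
Definition cech_valid (F : int -> R -> Prop) (a : seq R) (i : nat) (j : int)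
    (N : nat) (c : {set 'I_(size a).+1} -> R) :=
  forall S : {set 'I_(size a).+1}, #|S| = i -> F (j + N%:Z * cech_e S) (c S).

(* numerator of the T-component of the Cech differential of (N, c);
   its denominator is x_T^N *)
Definition cech_d (a : seq R) (N : nat) (c : {set 'I_(size a).+1} -> R)
    (T : {set 'I_(size a).+1}) : R :=
  \sum_(k in T) (-1) ^+ #|[set l in T | (l < k)%N]| * c (T :\ k) * cech_gen k ^+ N.

Definition cech_cocycle (a : seq R) (i : nat) (N : nat) (c : {set 'I_(size a).+1} -> R) :=
  forall T : {set 'I_(size a).+1}, #|T| = i.+1 ->
    exists L : nat, cech_b T ^+ L * cech_d N c T = 0.

Definition cech_coboundary (F : int -> R -> Prop) (a : seq R) (i : nat) (j : int)
    (N : nat) (c : {set 'I_(size a).+1} -> R) :=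
  exists (N' : nat) (c' : {set 'I_(size a).+1} -> R),
    cech_valid F i.-1 j N' c' /\
    forall S : {set 'I_(size a).+1}, #|S| = i ->
      exists L : nat,
        cech_b S ^+ L * (cech_b S ^+ N' * c S - cech_b S ^+ N * cech_d N' c' S) = 0.

Definition loc_coh_vanish (F : int -> R -> Prop) (a : seq R) (i : nat) (j : int) :=
  forall (N : nat) (c : {set 'I_(size a).+1} -> R),
    cech_valid F i j N c -> cech_cocycle i N c -> cech_coboundary F i j N c.

End CommAlg.

(* Main.v *)
(** Put [N = (+)_n R / I_n], the quotient of [R[t, t^-1]] by [R'(F)], and let
    [T_k] be multiplication by [a_k t] on it.  As [t^-1] is invertible on
    [R[t, t^-1]], the connecting map turns the vanishing of [H^(i+1)_J(R'(F))] in
    degree [r - i] into that of [H^i_T(N)] in degree [r - i], for [0 <= i < g].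

    The ideal [(T)^n] of [R[T_1, ..., T_g]] has a linear resolution of length [g];
    its [p]-th syzygies are [Z_p = ker dY] in [/\^p (x) Sym^n], where [dY] and [dT]
    are the Koszul differentials [e_k |-> Y_k] and [e_k |-> T_k] and the map
    [Z_(p+1) -> Z_p] is [dT].  This complex becomes exact over every localization
    of [N] at some [T_k].  Comparing it with the Cech complex of [N] in a double
    complex, exactly the groups [H^p_T(N)_(r-p)], [0 <= p < g], obstruct the
    exactness of [Z_1 (x) N_(r-1) -> Sym^n (x) N_r -> N_(n+r)].  So if
    [x = \sum_alpha c_alpha a^alpha] lies in [I_(n+r)], then modulo [I_r] the
    coefficients [c_alpha] are a combination of linear syzygies of the [a^alpha],
    whence [x] lies in [I^n I_r]. *)
Require Import Defs.
From HB Require Import structures.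
From mathcomp Require Import all_boot all_order all_algebra.
From mathcomp Require Import boolp functions ring zify.
Import Order.TTheory GRing.Theory Num.Theory.
Set Implicit Arguments. Unset Strict Implicit. Unset Printing Implicit Defensive.
Local Open Scope ring_scope.

(** * Alternating double sums and Koszul signs *)

Lemma antisym_sum0 (A : zmodType) g (f : 'I_g -> 'I_g -> A) :
  (forall k, f k k = 0) -> (forall k l, f k l = - f l k) ->
  \sum_k \sum_l f k l = 0.
Proof.
move=> f0 fN.
(* The two strict triangles cancel in pairs; the zero diagonal is assumed separately because
   antisymmetry only gives [f k k + f k k = 0]. *)
have split_lt k : \sum_l f k l = \sum_(l : 'I_g | (l < k)%N) f k l + \sum_(l : 'I_g | (k < l)%N) f k l.
  rewrite (bigID (fun l : 'I_g => (l < k)%N)) /=; congr (_ + _).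
  rewrite (bigID (fun l => l == k)) /= [X in X + _]big1 ?add0r; last first.
    by move=> l /andP[_ /eqP->]; rewrite f0.
  apply: eq_bigl => l.
  by rewrite -leqNgt ltn_neqAle eq_sym andbC.
rewrite (eq_bigr _ (fun k _ => split_lt k)) big_split /=.
rewrite [X in _ + X](exchange_big_dep predT) //= -big_split big1 //= => k _.
rewrite [X in _ + X](eq_bigr (fun i => - f k i)) // sumrN.
by rewrite subrr.
Qed.

Section Sign.
Variables (R : comNzRingType) (g : nat).
Implicit Types (k l : 'I_g) (u : {set 'I_g}).

(** For [k \notin u], the sign that sorts [e_k /\ e_u] into increasing order. *)
Definition sgn k u : R := (-1) ^+ #|[set l in u | (l < k)%N]|.

Lemma sgnU1 k l u : k \notin u -> sgn l (k |: u) = (-1) ^+ (k < l)%N * sgn l u.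
Proof.
move=> ku; rewrite /sgn -exprD; congr (_ ^+ _).
case: ltnP => kl.
  have -> : [set x in k |: u | (x < l)%N] = k |: [set x in u | (x < l)%N].
    by apply/setP=> x; rewrite !inE; case: eqP => [->|].
  by rewrite cardsU1 inE (negPf ku).
rewrite add0n; apply: eq_card => x; rewrite !inE.
by case: eqP => [->|_] //=; rewrite (ltnNge k) kl andbF.
Qed.

Lemma sgnD1 k l u : k \in u -> sgn l u = (-1) ^+ (k < l)%N * sgn l (u :\ k).
Proof. by move=> ku; rewrite -{1}(setD1K ku) sgnU1 ?setD11. Qed.

Lemma sgnK k u : sgn k u * sgn k u = 1.
Proof. by rewrite /sgn -expr2 sqrr_sign. Qed.

Lemma sgn_first k u : (forall l, (l < k)%N -> l \notin u) -> sgn k u = 1.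
Proof.
move=> H; rewrite /sgn (_ : [set l in u | _] = set0) ?cards0 //.
apply/setP=> l; rewrite !inE; apply/negbTE/negP=> /andP[lu /H].
by rewrite lu.
Qed.

Lemma sgn_swap k l : k != l -> (-1) ^+ (k < l)%N = - (-1) ^+ (l < k)%N :> R.
Proof.
rewrite -val_eqE neq_ltn => /orP[] H; rewrite H ltnNge (ltnW H) /= ?expr0 ?expr1 ?opprK //.
Qed.

End Sign.

(** * The two Koszul differentials and a contracting homotopy for [dY] *)

Section Koszul.
Variables (R : comNzRingType) (g : nat) (X : lmodType R) (a : 'I_g -> R).
Implicit Types (k l : 'I_g) (u : {set 'I_g}) (al : {ffun 'I_g -> nat}).

(* [w u al] is the coefficient of [Y^al e_u] in an element of
   [/\ (R^g) (x) R[Y_1,...,Y_g] (x) X]. *)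
Local Notation form := ({set 'I_g} -> {ffun 'I_g -> nat} -> X).
Implicit Types w : form.

Definition mdeg al := (\sum_k al k)%N.
Definition incr k al : {ffun 'I_g -> nat} := [ffun l => al l + (l == k)]%N.
Definition decr k al : {ffun 'I_g -> nat} := [ffun l => al l - (l == k)]%N.

Lemma incrK k al : decr k (incr k al) = al.
Proof. by apply/ffunP=> l; rewrite !ffunE addnK. Qed.

Lemma decrK k al : (0 < al k)%N -> incr k (decr k al) = al.
Proof.
move=> H; apply/ffunP=> l; rewrite !ffunE subnK //.
by case: eqP => [->|].
Qed.

Lemma decr_incr k l al : k != l -> decr k (incr l al) = incr l (decr k al).
Proof.
move=> kl; apply/ffunP=> x; rewrite !ffunE.
by case: (eqVneq x k) => [->|_]; rewrite ?(negPf kl) ?subn0 ?addn0.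
Qed.

Lemma decrC k l al : decr k (decr l al) = decr l (decr k al).
Proof. by apply/ffunP=> x; rewrite !ffunE subnAC. Qed.

Lemma mdeg_incr k al : mdeg (incr k al) = (mdeg al).+1.
Proof.
rewrite /mdeg (eq_bigr (fun l => al l + (l == k))%N); last by move=> l _; rewrite ffunE.
rewrite big_split /= -addn1; congr (_ + _)%N.
by rewrite (bigD1 k) //= eqxx big1 // => l /negPf->.
Qed.

Lemma mdeg_decr k al : (0 < al k)%N -> mdeg al = (mdeg (decr k al)).+1.
Proof. by move=> H; rewrite -{1}(decrK H) mdeg_incr. Qed.

(** Contraction against the dual of [e_k]; [ext] is left multiplication by [e_k]. Both give the
    coefficient of [e_u] in the result, so contraction reads [w] at the larger set. *)
Definition iota_ k w : form :=
  fun u al => if k \in u then 0 else sgn R k u *: w (k |: u) al.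
Definition ext k w : form :=
  fun u al => if k \in u then sgn R k u *: w (u :\ k) al else 0.
Definition mulY k w : form :=
  fun u al => if (0 < al k)%N then w u (decr k al) else 0.
Definition dY w : form := \sum_k mulY k (iota_ k w).
Definition dT w : form := \sum_k a k *: iota_ k w.

(* [hY] divides by [Y_k] and multiplies by [e_k], [k] being the smallest index in
   the monomial; monomials in which [e_k] already occurs are sent to 0. *)
Definition first u al k :=
  (k \in u) && [forall l : 'I_g, (l < k)%N ==> (l \notin u) && (al l == 0%N)].
Definition hY w : form :=
  fun u al => \sum_(k | first u al k) w (u :\ k) (incr k al).

Lemma dYE w u al : dY w u al = \sum_k mulY k (iota_ k w) u al.
Proof. by rewrite /dY !fct_sumE. Qed.
Lemma dTE w u al : dT w u al = \sum_k a k *: iota_ k w u al.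
Proof. by rewrite /dT !fct_sumE. Qed.

Lemma fcoefP w1 w2 : (forall u al, w1 u al = w2 u al) -> w1 = w2.
Proof. by move=> H; apply: funext => u; apply: funext => al. Qed.

Lemma fcoefD w1 w2 u al : (w1 + w2) u al = w1 u al + w2 u al.
Proof. by []. Qed.
Lemma fcoefB w1 w2 u al : (w1 - w2) u al = w1 u al - w2 u al.
Proof. by []. Qed.
Lemma fcoefZ c w1 u al : (c *: w1) u al = c *: w1 u al.
Proof. by []. Qed.
Lemma fcoefN w1 u al : (- w1) u al = - w1 u al.
Proof. by []. Qed.

Lemma iota_anti k l w : iota_ k (iota_ l w) = - iota_ l (iota_ k w).
Proof.
apply: fcoefP => u al; rewrite /iota_ /= fcoefN !in_setU1.
case: (boolP (k \in u)) => [|ku]; case: (boolP (l \in u)) => [|lu];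
  rewrite ?orbT ?scaler0 ?oppr0 //= ?orbF.
rewrite (eq_sym l k); case: (eqVneq k l) => [|kl]; first by rewrite !scaler0 oppr0.
rewrite !scalerA -scaleNr setUCA; congr (_ *: _).
rewrite !sgnU1 // (sgn_swap R kl); ring.
Qed.

Lemma iota_iota k w : iota_ k (iota_ k w) = 0.
Proof.
apply: fcoefP => u al; rewrite /iota_.
by case: ifP => // _; rewrite setU11 scaler0.
Qed.

(** The Clifford relation. Summed against the [a_k] or the [Y_k], it makes [ext k] a homotopy for
    multiplication by [a_k] under [dT] and by [Y_k] under [dY]. *)
Lemma iota_ext k l w :
  iota_ k (ext l w) = (if k == l then w else 0) - ext l (iota_ k w).
Proof.
apply: fcoefP => u al; rewrite fcoefB.
rewrite /iota_ /ext; case: (eqVneq k l) => [<-{l}|kl].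
  rewrite setU11 setD11; case: (boolP (k \in u)) => ku.
    by rewrite scalerA (sgnD1 R k ku) ltnn mul1r sgnK scale1r setD1K // subrr.
  rewrite subr0 scalerA sgnU1 // ltnn mul1r sgnK scale1r.
  by rewrite setU1K.
rewrite /= sub0r !inE (eq_sym l k) (negPf kl) /=.
case: (boolP (k \in u)) => ku; case: (boolP (l \in u)) => lu;
  rewrite ?scaler0 ?oppr0 //=.
rewrite !scalerA -scaleNr; congr (_ *: w _ al).
  rewrite sgnU1 // (sgnD1 R k lu) (sgn_swap R kl).
  have := sqrr_sign R (l < k)%N; set s := _ ^+ (l < k)%N => s2; ring: s2.
by apply/setP=> x; rewrite !inE; case: (eqVneq x k) => [->|//]; rewrite kl.
Qed.

Fact iota_linear k : linear (iota_ k).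
Proof.
move=> c w1 w2; apply: fcoefP => u al; rewrite fcoefD fcoefZ /iota_ fcoefD fcoefZ.
case: ifP => _; first by rewrite scaler0 addr0.
by rewrite scalerDr !scalerA mulrC.
Qed.
HB.instance Definition _ k := GRing.isLinear.Build R form form *:%R (iota_ k) (iota_linear k).

Fact ext_linear k : linear (ext k).
Proof.
move=> c w1 w2; apply: fcoefP => u al; rewrite fcoefD fcoefZ /ext fcoefD fcoefZ.
case: ifP => _; last by rewrite scaler0 addr0.
by rewrite scalerDr !scalerA mulrC.
Qed.
HB.instance Definition _ k := GRing.isLinear.Build R form form *:%R (ext k) (ext_linear k).

Fact mulY_linear k : linear (mulY k).
Proof.
move=> c w1 w2; apply: fcoefP => u al; rewrite fcoefD fcoefZ /mulY fcoefD fcoefZ.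
by case: ifP => _; rewrite ?scaler0 ?addr0.
Qed.
HB.instance Definition _ k := GRing.isLinear.Build R form form *:%R (mulY k) (mulY_linear k).

Fact hY_linear : linear hY.
Proof.
move=> c w1 w2; apply: fcoefP => u al; rewrite fcoefD fcoefZ /hY.
by rewrite big_split /= scaler_sumr.
Qed.
HB.instance Definition _ := GRing.isLinear.Build R form form *:%R hY hY_linear.

Fact dY_linear : linear dY.
Proof.
move=> c w1 w2; rewrite /dY scaler_sumr -big_split; apply: eq_bigr => k _ /=.
by rewrite !linearP.
Qed.
HB.instance Definition _ := GRing.isLinear.Build R form form *:%R dY dY_linear.

Fact dT_linear : linear dT.
Proof.
move=> c w1 w2; rewrite /dT scaler_sumr -big_split; apply: eq_bigr => k _ /=.
by rewrite [iota_ k _]linearP scalerDr !scalerA mulrC.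
Qed.
HB.instance Definition _ := GRing.isLinear.Build R form form *:%R dT dT_linear.

Lemma iota_mulY k l w : iota_ k (mulY l w) = mulY l (iota_ k w).
Proof.
apply: fcoefP => u al; rewrite /iota_ /mulY.
by do 2 case: ifP => //; rewrite scaler0.
Qed.

Lemma ext_mulY k l w : ext k (mulY l w) = mulY l (ext k w).
Proof.
apply: fcoefP => u al; rewrite /ext /mulY.
by do 2 case: ifP => //; rewrite scaler0.
Qed.

Lemma mulYC k l w : mulY k (mulY l w) = mulY l (mulY k w).
Proof.
apply: fcoefP => u al; rewrite /mulY decrC !ffunE (eq_sym l).
case: (eqVneq k l) => [->//|_]; rewrite !subn0.
by do 2 case: ifP => //.
Qed.

Lemma dT_dT w : dT (dT w) = 0.
Proof.
rewrite /dT -[RHS](antisym_sum0 (f := fun k l => (a k * a l) *: iota_ k (iota_ l w))).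
- apply: eq_bigr => k _; rewrite linear_sum scaler_sumr.
  by apply: eq_bigr => l _; rewrite linearZ /= scalerA.
- by move=> k; rewrite iota_iota scaler0.
- by move=> k l; rewrite iota_anti scalerN mulrC.
Qed.

Lemma dY_dY w : dY (dY w) = 0.
Proof.
rewrite /dY -[RHS](antisym_sum0 (f := fun k l => mulY k (mulY l (iota_ k (iota_ l w))))).
- apply: eq_bigr => k _; rewrite !linear_sum.
  by apply: eq_bigr => l _; rewrite /= iota_mulY.
- by move=> k; rewrite iota_iota !linear0.
- by move=> k l; rewrite iota_anti !linearN mulYC.
Qed.

Lemma dY_dT w : dY (dT w) = - dT (dY w).
Proof.
rewrite /dY /dT -sumrN.
under eq_bigr do rewrite !linear_sum.
under [RHS]eq_bigr do rewrite linear_sum scaler_sumr -sumrN.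
rewrite exchange_big; apply: eq_bigr => k _; apply: eq_bigr => l _.
by rewrite !linearZ /= iota_mulY iota_anti linearN scalerN.
Qed.

Lemma dT_ext k w : dT (ext k w) = a k *: w - ext k (dT w).
Proof.
rewrite /dT linear_sum -[a k *: w](_ : \sum_l (if l == k then a l *: w else 0) = _).
  rewrite -sumrB; apply: eq_bigr => l _; rewrite iota_ext scalerBr /= [ext k (_ *: _)]linearZ.
  by case: ifP; rewrite ?scaler0.
by rewrite -big_mkcond big_pred1_eq.
Qed.

Lemma dY_ext k w : dY (ext k w) = mulY k w - ext k (dY w).
Proof.
rewrite /dY linear_sum -[mulY k w](_ : \sum_l (if l == k then mulY l w else 0) = _).
  rewrite -sumrB; apply: eq_bigr => l _; rewrite /= iota_ext linearB /= ext_mulY.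
  by case: ifP; rewrite ?[mulY _ 0]linear0.
by rewrite -big_mkcond big_pred1_eq.
Qed.

Lemma dT_mulY k w : dT (mulY k w) = mulY k (dT w).
Proof.
by rewrite /dT linear_sum; apply: eq_bigr => l _; rewrite iota_mulY linearZ.
Qed.

Lemma dY_mulY k w : dY (mulY k w) = mulY k (dY w).
Proof.
by rewrite /dY linear_sum; apply: eq_bigr => l _; rewrite iota_mulY mulYC.
Qed.

Lemma firstP u al k :
  reflect (k \in u /\ forall l, (l < k)%N -> l \notin u /\ al l = 0%N) (first u al k).
Proof.
apply: (iffP andP) => -[ku H]; split=> //.
  by move=> l lk; have /implyP/(_ lk)/andP[? /eqP] := forallP H l.
by apply/forallP=> l; apply/implyP=> /H[-> ->]; rewrite eqxx.
Qed.

Lemma hY_first w u al k : first u al k -> hY w u al = w (u :\ k) (incr k al).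
Proof.
move=> fk; rewrite /hY (big_pred1 k) // => l /=.
apply/idP/eqP => [fl|->//].
have [ku Hk] := firstP _ _ _ fk; have [lu Hl] := firstP _ _ _ fl.
apply/eqP; rewrite -val_eqE; case: ltngtP => //.
  by move=> /Hk []; rewrite lu.
by move=> /Hl []; rewrite ku.
Qed.

Lemma hY_nofirst w u al : (forall k, ~~ first u al k) -> hY w u al = 0.
Proof. by move=> H; rewrite /hY big_pred0 // => k; apply/negbTE. Qed.

(** Let [m] be the least index occurring in [u] or [al]. If [m] is in [u], the [m]-term of
    [hY (dY w)] is the wanted coefficient and the other terms cancel against [dY (hY w)], since
    adding a larger index keeps [m] first. If not, [hY (dY w)] has no first index and vanishes, and
    only the [m]-term of [dY (hY w)] survives. No division by integers occurs, so the characteristic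
    is arbitrary. *)
Lemma homotopyY w u al :
  (exists k, (k \in u) || (0 < al k)%N) -> dY (hY w) u al + hY (dY w) u al = w u al.
Proof.
case=> k0 Pk0.
case: (@arg_minnP _ k0 (fun k => (k \in u) || (0 < al k)%N) (fun k => k)) => // m Pm minm.
have low l : (l < m)%N -> l \notin u /\ al l = 0%N.
  move=> lm; have := contra (minm l); rewrite -ltnNge lm => /(_ isT).
  by rewrite negb_or lt0n negbK => /andP[? /eqP].
case: (boolP (m \in u)) => mu.
  have fm : first u al m by apply/firstP.
  rewrite (hY_first _ fm) !dYE addrC (bigD1 m) //= -addrA.
  rewrite {1}/mulY !ffunE eqxx addn1 /= incrK /iota_ setD11 setD1K //.
  rewrite sgn_first ?scale1r; last first.
    by move=> l /low[lu _]; rewrite !inE negb_and lu orbT.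
  rewrite [X in _ + (_ + X)](bigD1 m) //=.
  rewrite [X in _ + (_ + (X + _))](_ : _ = 0) ?add0r; last first.
    by rewrite /mulY mu; case: ifP.
  rewrite -big_split big1 ?addr0 //= => k km.
  rewrite /mulY ffunE (negPf km) addn0 !inE km /=.
  case: (boolP (k \in u)) => ku; first by case: ifP; rewrite addr0.
  case: ltnP => // ak; last by rewrite addr0.
  have mk : (m < k)%N.
    by rewrite ltn_neqAle eq_sym val_eqE km minm // ak orbT.
  rewrite (@hY_first _ _ _ m); last first.
    apply/firstP; split; first by rewrite !inE mu orbT.
    move=> l lm; have [lu al0] := low l lm; rewrite !inE negb_or lu andbT ffunE al0 sub0n.
    by split=> //; rewrite -val_eqE; rewrite ltn_eqF // (ltn_trans lm).
  rewrite (sgnD1 R k mu) mk expr1 mulN1r scaleNr decr_incr //.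
  rewrite (_ : (k |: u) :\ m = k |: u :\ m) ?subrr //.
  by apply/setP=> x; rewrite !inE; case: (eqVneq x k) => [->|//]; rewrite km.
have am : (0 < al m)%N by move: Pm; rewrite (negPf mu).
rewrite [hY (dY w) u al]hY_nofirst ?addr0; last first.
  move=> k; apply/negP=> /firstP[ku /(_ m) mk].
  have : (m <= k)%N by apply: minm; rewrite ku.
  rewrite leq_eqVlt => /orP[/eqP/val_inj mk0|/mk[_ am0]].
    by rewrite mk0 ku in mu.
  by rewrite am0 in am.
rewrite dYE (bigD1 m) //= big1 ?addr0.
  rewrite /mulY am /iota_ (negPf mu) (@hY_first _ _ _ m).
    rewrite sgn_first ?scale1r ?setU1K ?decrK //.
    by move=> l /low[].
  apply/firstP; split; first by rewrite setU11.
  move=> l lm; have [lu al0] := low l lm; rewrite !inE negb_or lu andbT ffunE al0 sub0n.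
  by split=> //; rewrite -val_eqE ltn_eqF.
move=> k km; rewrite /mulY /iota_; case: ltnP => // ak; case: ifP => // ku.
rewrite hY_nofirst ?scaler0 // => q; apply/negP=> /firstP[].
rewrite !inE => qku /(_ m); rewrite ffunE eq_sym (negPf km) subn0.
have : (m <= q)%N by apply: minm; case/orP: qku => [/eqP->|->//]; rewrite ak orbT.
rewrite leq_eqVlt => /orP[/eqP/val_inj mq|mq /(_ mq)[_ am0]].
  by move: qku; rewrite -mq eq_sym (negPf km) (negPf mu).
by rewrite am0 in am.
Qed.

(* Substitution of [a_k] for [Y_k] in exterior degree 0: it equates [dY] and [dT],
   and [w = dY (hY w)] in positive degree. *)
Fixpoint eps n w : X :=
  if n is n'.+1 then eps n' (dT (hY w)) else w set0 [ffun=> 0%N].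

Fact eps_linear n : linear (eps n).
Proof.
elim: n => [|n IH] c w1 w2 //=.
by rewrite !linearP IH.
Qed.

End Koszul.

(** * Forms of a given bidegree with coefficients in a submodule *)

Section Coefficientwise.
Variables (R : comNzRingType) (g : nat) (X : lmodType R) (a : 'I_g -> R).
Implicit Types (k l : 'I_g) (u : {set 'I_g}) (al : {ffun 'I_g -> nat}) (P : X -> Prop).
Local Notation form := ({set 'I_g} -> {ffun 'I_g -> nat} -> X).
Implicit Types w : form.

Definition submod P :=
  [/\ P 0, forall x y, P x -> P y -> P (x + y) & forall c x, P x -> P (c *: x)].

Lemma submodN P x : submod P -> P x -> P (- x).
Proof. by move=> [_ _ PZ] Px; rewrite -scaleN1r; apply: PZ. Qed.

Lemma submodB P x y : submod P -> P x -> P y -> P (x - y).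
Proof. by move=> sP Px Py; have [_ PD _] := sP; apply: PD => //; apply: submodN. Qed.

Lemma submod_sum P (I : Type) (s : seq I) (Q : pred I) (f : I -> X) :
  submod P -> (forall i, Q i -> P (f i)) -> P (\sum_(i <- s | Q i) f i).
Proof. by move=> [P0 PD _] H; elim/big_rec: _ => // i x Qi; apply: PD; apply: H. Qed.

Definition on P p n w := forall u al, #|u| = p -> mdeg al = n -> P (w u al).
(* [on] in exterior degree [p - 1], hence void for [p = 0]. *)
Definition onm P p n w := forall u al, #|u|.+1 = p -> mdeg al = n -> P (w u al).

Lemma onmS P p n w : onm P p.+1 n w <-> on P p n w.
Proof. by split=> H u al hu; apply: H; [rewrite hu | case: hu]. Qed.

Section Closure.
Variable P : X -> Prop.
Hypothesis sP : submod P.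

Lemma on0 p n : on P p n 0.
Proof. by have [P0 _ _] := sP. Qed.

Lemma onD p n w1 w2 : on P p n w1 -> on P p n w2 -> on P p n (w1 + w2).
Proof. by have [_ PD _] := sP; move=> H1 H2 u al hu ha; apply: PD; [apply: H1|apply: H2]. Qed.

Lemma onN p n w : on P p n w -> on P p n (- w).
Proof. by move=> H u al hu ha; apply: submodN => //; apply: H. Qed.

Lemma onB p n w1 w2 : on P p n w1 -> on P p n w2 -> on P p n (w1 - w2).
Proof. by move=> H1 H2; apply: onD => //; apply: onN. Qed.

Lemma on_sum p n (I : finType) (f : I -> form) :
  (forall i, on P p n (f i)) -> on P p n (\sum_i f i).
Proof.
move=> H u al hu ha; rewrite !fct_sumE; apply: submod_sum => // i _.
exact: H.
Qed.

Lemma onmN p n w : onm P p n w -> onm P p n (- w).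
Proof. by case: p => [_ u|p /onmS H]; last by apply/onmS; apply: onN. Qed.

Lemma onmB p n w1 w2 : onm P p n w1 -> onm P p n w2 -> onm P p n (w1 - w2).
Proof.
by case: p => [_ _ u|p /onmS H /onmS H']; last by apply/onmS; apply: onB.
Qed.

Lemma onmD p n w1 w2 : onm P p n w1 -> onm P p n w2 -> onm P p n (w1 + w2).
Proof.
by case: p => [_ _ u|p /onmS H /onmS H']; last by apply/onmS; apply: onD.
Qed.

Lemma onm_dY p n w : on P p n w -> onm P p n.+1 (dY w).
Proof.
have [P0 PD PZ] := sP.
move=> H u al hu ha; rewrite dYE; apply: submod_sum => // k _.
rewrite /mulY /iota_; case: ltnP => // ak; case: (boolP (k \in u)) => // ku.
apply: PZ; apply: H; first by rewrite cardsU1 ku.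
by move: ha; rewrite (mdeg_decr ak) => -[].
Qed.

Lemma on_hY p n w : onm P p n.+1 w -> on P p n (hY w).
Proof.
move=> H u al hu ha; rewrite /hY; apply: submod_sum => // k /andP[ku _].
apply: H; last by rewrite mdeg_incr ha.
by rewrite -hu (cardsD1 k u) ku.
Qed.

Lemma on_ext p n k w : onm P p n w -> on P p n (ext k w).
Proof.
have [P0 PD PZ] := sP.
move=> H u al hu ha; rewrite /ext; case: ifP => // ku; apply: PZ; apply: H => //.
by rewrite -hu (cardsD1 k u) ku.
Qed.

Lemma on_mulY p n k w : on P p n w -> on P p n.+1 (mulY k w).
Proof.
have [P0 PD PZ] := sP.
move=> H u al hu ha; rewrite /mulY; case: ifP => // ak; apply: H => //.
by move: ha; rewrite (mdeg_decr ak) => -[].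
Qed.

Lemma homotopy_on p n w : onm P p n.+2 (dY w) -> on P p n.+1 (w - dY (hY w)).
Proof.
move=> H u al hu ha.
have -> : (w - dY (hY w)) u al = hY (dY w) u al.
  rewrite fcoefB -{1}(@homotopyY _ _ _ w) 1?addrC ?addKr ?addrK //.
  have : (0 < mdeg al)%N by rewrite ha.
  rewrite lt0n sum_nat_eq0 negb_forall => /existsP[k]; rewrite -lt0n => ak.
  by exists k; rewrite ak orbT.
exact: (on_hY H).
Qed.

(* A top coefficient of a [dY]-cycle is itself a coefficient of its boundary. *)
Lemma on_top p n w k u al : (forall l, l != k -> l \in u \/ al l = 0%N) ->
  onm P p n.+1 (dY w) -> k \in u -> #|u| = p -> mdeg al = n -> P (w u al).
Proof.
have [P0 PD PZ] := sP.
move=> H HY ku hu ha.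
have : P (dY w (u :\ k) (incr k al)).
  by apply: HY; [rewrite -hu (cardsD1 k u) ku | rewrite mdeg_incr ha].
rewrite dYE (bigD1 k) //= big1 ?addr0 => [|l lk]; last first.
  rewrite /mulY /iota_ ffunE (negPf lk) addn0 !inE lk /=.
  by case: (H l lk) => [->|->] //; case: ifP.
rewrite /mulY ffunE eqxx addn1 /= incrK /iota_ setD11 setD1K //.
by move/(PZ (sgn R k (u :\ k))); rewrite scalerA sgnK scale1r.
Qed.

End Closure.

Lemma onm_dT P P' p n w : submod P' -> (forall k x, P x -> P' (a k *: x)) ->
  on P p n w -> onm P' p n (dT a w).
Proof.
move=> sP' Pa H u al hu ha; have [P0 _ PZ] := sP'.
rewrite dTE; apply: submod_sum => // k _.
rewrite /iota_; case: (boolP (k \in u)) => ku; first by rewrite scaler0.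
rewrite scalerA mulrC -scalerA; apply: PZ; apply: Pa; apply: H => //.
by rewrite cardsU1 ku.
Qed.

End Coefficientwise.

(** * Functoriality in the coefficient module *)

Section Map.
Variables (R : comNzRingType) (g : nat) (X X' : lmodType R) (a : 'I_g -> R).
Variable f : {linear X -> X'}.
Local Notation form := ({set 'I_g} -> {ffun 'I_g -> nat} -> X).
Implicit Types w : form.

Definition fmap w : {set 'I_g} -> {ffun 'I_g -> nat} -> X' := fun u al => f (w u al).

Lemma fmapB w1 w2 : fmap (w1 - w2) = fmap w1 - fmap w2.
Proof. by apply: fcoefP => u al; rewrite /fmap fcoefB linearB. Qed.

Lemma fmap_iota k w : fmap (iota_ k w) = iota_ k (fmap w).
Proof. by apply: fcoefP => u al; rewrite /fmap /iota_; case: ifP; rewrite ?linear0 ?linearZ. Qed.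

Lemma fmap_mulY k w : fmap (mulY k w) = mulY k (fmap w).
Proof. by apply: fcoefP => u al; rewrite /fmap /mulY; case: ifP; rewrite ?linear0. Qed.

Lemma fmap_hY w : fmap (hY w) = hY (fmap w).
Proof. by apply: fcoefP => u al; rewrite /fmap /hY linear_sum. Qed.

Lemma fmap_dY w : fmap (dY w) = dY (fmap w).
Proof.
apply: fcoefP => u al; rewrite /fmap dYE linear_sum dYE; apply: eq_bigr => k _.
by rewrite -/(fmap w) -fmap_iota -fmap_mulY.
Qed.

Lemma fmap_dT w : fmap (dT a w) = dT a (fmap w).
Proof.
apply: fcoefP => u al; rewrite /fmap dTE linear_sum dTE; apply: eq_bigr => k _.
by rewrite -/(fmap w) -fmap_iota linearZ.
Qed.

Lemma fmap_eps n w : eps a n (fmap w) = f (eps a n w).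
Proof. by elim: n w => //= n IH w; rewrite -fmap_hY -fmap_dT IH. Qed.

Lemma on_fmap (P : X -> Prop) (P' : X' -> Prop) p n w : (forall x, P x -> P' (f x)) -> on P p n w -> on P' p n (fmap w).
Proof. by move=> Pf H u al hu ha; apply: Pf; apply: H. Qed.

Lemma onm_fmap (P : X -> Prop) (P' : X' -> Prop) p n w : (forall x, P x -> P' (f x)) -> onm P p n w -> onm P' p n (fmap w).
Proof. by move=> Pf H u al hu ha; apply: Pf; apply: H. Qed.

End Map.

(** * The double complex of syzygies and Cech cochains *)

Section Chase.
Variables (R : comNzRingType) (g : nat) (X : lmodType R) (a : 'I_g -> R).
Local Notation form := ({set 'I_g} -> {ffun 'I_g -> nat} -> X).
Implicit Types w : form.

(* [V i j / B i j] plays the role of the degree [j] part of the [i]-th term of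
   a Cech complex on which [a k] acts with degree 1, and [sg] that of a family
   of operators of degree -1 with [\sum_k a_k sg_k = 1] on the terms [i > 0]. *)
Variables V B : nat -> int -> X -> Prop.
Variables (D : {linear X -> X}) (sg : 'I_g -> {linear X -> X}).
Hypothesis Vs : forall i j, submod (V i j).
Hypothesis Bs : forall i j, submod (B i j).
Hypothesis V_a : forall i j k x, V i j x -> V i (j + 1) (a k *: x).
Hypothesis B_a : forall i j k x, B i j x -> B i (j + 1) (a k *: x).
Hypothesis V_sg : forall i j k x, V i j x -> V i (j - 1) (sg k x).
Hypothesis B_sg : forall i j k x, B i j x -> B i (j - 1) (sg k x).
Hypothesis sgE : forall i j x, V i.+1 j x -> B i.+1 j (\sum_k a k *: sg k x - x).

(** Exactness of the syzygy complex where the [a_k] generate the unit ideal, everything read modulo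
    [B]. By induction on [n]: [hY w] is a [dY]-primitive of [w], and the induction hypothesis
    corrects it to one killed by [dT]. The condition on [eps] is the cycle condition at the
    augmented end [p = 0]. *)
Lemma local_exact i n p j w :
  on (V i.+1 j) p n w -> onm (B i.+1 j) p n.+1 (dY w) ->
  onm (B i.+1 (j + 1)) p n (dT a w) ->
  (p = 0%N -> B i.+1 (j + n%:Z) (eps a n w)) ->
  exists v, [/\ on (V i.+1 (j - 1)) p.+1 n v,
    on (B i.+1 (j - 1)) p n.+1 (dY v) & on (B i.+1 j) p n (dT a v - w)].
Proof.
(* For [n = 0] the form [w] is itself zero modulo [B]: coefficients with [u] nonempty are
   coefficients of [dY w], and the remaining one is [eps a 0 w]. *)
elim: n p j w => [|n IH] p j w Vw Yw Tw Ew.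
  exists 0; split; first exact: on0.
    by rewrite linear0; apply: on0.
  rewrite linear0 sub0r; apply: onN => // u al hu ha.
  have al0 l : al l = 0%N.
    by apply/eqP; move/eqP: ha; rewrite sum_nat_eq0 => /forallP/(_ l).
  case: (set_0Vmem u) => [u0|[k ku]]; last first.
    by apply: (on_top (Bs i.+1 j) (k := k)) Yw _ _ _ => // l _; right.
  move: hu; rewrite u0 cards0 => /esym/Ew; rewrite addr0 /=.
  by congr (B _ _ (w _ _)); apply/ffunP=> l; rewrite ffunE al0.
pose x := hY w.
have Yx : on (B i.+1 j) p n.+1 (w - dY x) by apply: homotopy_on.
have Vx : on (V i.+1 j) p.+1 n x by apply: on_hY => //; apply/onmS.
have [v' [Vv' Yv' Tv']] : exists v, [/\ on (V i.+1 j) p.+1 n v,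
    on (B i.+1 j) p n.+1 (dY v) & on (B i.+1 (j + 1)) p n (dT a v - dT a x)].
  have := IH p (j + 1) (dT a x); rewrite addrK; apply.
  - by apply/onmS; apply: onm_dT Vx => //; apply: V_a.
  - rewrite dY_dT; apply: onmN => //.
    rewrite -[dY x](subKr w) linearB; apply: onmB => //.
    by apply: onm_dT Yx => //; apply: B_a.
  - by rewrite dT_dT => u al _ _; have [] := Bs i.+1 (j + 1 + 1).
  (* [eps a n.+1 w] unfolds to [eps a n (dT a (hY w))], so the condition passes to [dT a x]. *)
  - by move=> p0; rewrite -addrA -intS; apply: Ew.
pose xt := x - v'.
have Yxt : on (B i.+1 j) p n.+1 (w - dY xt).
  by rewrite linearB opprB addrCA; apply: onD => //.
have Txt : on (B i.+1 (j + 1)) p n (dT a xt).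
  by rewrite linearB -opprB; apply: onN.
have Vxt : on (V i.+1 j) p.+1 n xt by apply: onB.
(* Both differentials of [e_k] being known, [dY v = 0] and [dT v = w] follow from
   [dY xt = w], [dT xt = 0] and [\sum_k a_k sg_k = 1]. *)
pose v : form := \sum_k (ext k (fmap (sg k) w) - mulY k (fmap (sg k) xt)).
exists v; split.
- apply: on_sum => // k; apply: onB => //.
    by apply: on_ext => //; apply/onmS; apply: on_fmap Vw; apply: V_sg.
  by apply: on_mulY => //; apply: on_fmap Vxt; apply: V_sg.
- rewrite linear_sum; apply: on_sum => // k /=.
  rewrite linearB /= dY_ext dY_mulY addrAC -linearB -!fmap_dY -fmapB.
  apply: onB => //.
    by apply: on_mulY => //; apply: on_fmap Yxt; apply: B_sg.
  by apply: on_ext => //; apply: onm_fmap Yw; apply: B_sg.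
rewrite linear_sum.
rewrite (eq_bigr (fun k => a k *: fmap (sg k) w -
   (ext k (fmap (sg k) (dT a w)) + mulY k (fmap (sg k) (dT a xt))))); last first.
  move=> k _; rewrite [LHS]linearB /= dT_ext dT_mulY !fmap_dT opprD addrA //.
rewrite sumrB addrAC; apply: onB => //.
  move=> u al hu ha; have := sgE (Vw u al hu ha).
  by rewrite fcoefB !fct_sumE.
have jj : j = j + 1 - 1 by rewrite addrK.
apply: on_sum => // k; apply: onD => //.
  by apply: on_ext => //; apply: onm_fmap Tw => x0; rewrite {2}jj; apply: B_sg.
by apply: on_mulY => //; apply: on_fmap Txt => x0; rewrite {2}jj; apply: B_sg.
Qed.

Hypothesis DD : forall x, D (D x) = 0.
Hypothesis V_D : forall i j x, V i j x -> V i.+1 j (D x).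
Hypothesis B_D : forall i j x, B i j x -> B i.+1 j (D x).
Variable r : int.
Hypothesis g_gt0 : (0 < g)%N.
(** For [i = 0] the truncated [i.-1] is again 0; for the cochains used later [D y] vanishes on the
    empty set, so the condition then says that [x] itself is null. *)
Hypothesis acyclic : forall (i : nat) x, (i < g)%N -> V i (r - i%:Z) x ->
  B i.+1 (r - i%:Z) (D x) ->
  exists y, V i.-1 (r - i%:Z) y /\ B i (r - i%:Z) (x - D y).

(** Descending induction on [p]: [D w] lifts along [dT] to a form [w'] one column and one exterior
    degree higher, the induction hypothesis decomposes [w'], and what this leaves of [w] is a
    [D]-cocycle to which [acyclic] applies. *)
Lemma double_complex_chase n p w : (p <= g)%N ->
  on (V p (r - p%:Z)) p n.+1 w -> onm (B p (r - p%:Z)) p n.+2 (dY w) ->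
  onm (B p.+1 (r - p%:Z + 1)) p n.+1 (dT a (fmap D w)) ->
  (p = 0%N -> B 1 (r + n.+1%:Z) (eps a n.+1 (fmap D w))) ->
  exists v y, [/\ on (V p (r - p%:Z - 1)) p.+1 n.+1 v,
    on (B p (r - p%:Z - 1)) p n.+2 (dY v),
    on (V p.-1 (r - p%:Z)) p n.+1 y, onm (B p.-1 (r - p%:Z)) p n.+2 (dY y) &
    on (B p (r - p%:Z)) p n.+1 (w - dT a v - fmap D y)].
Proof.
move=> pg; rewrite -(subKn pg); move: (g - p)%N (leq_subr p g) => q.
elim: q w {p pg} => [|q IH] w; first rewrite subn0 => _ Vw Yw _ _.
  have fD0 : fmap D 0 = 0 :> form by apply: fcoefP => u al; rewrite /fmap linear0.
  (* At [p = g] only the full index set remains, and a [dY]-cycle of top exterior degree is zero by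
     [on_top]. *)
  exists 0, 0; rewrite !linear0 fD0 !subr0 ?addr0; split; try exact: on0.
    by case: (g) => [u //|p]; apply/onmS; apply: on0.
  move=> u al hu ha; have uT : u = setT.
    by apply/eqP; rewrite eqEcard subsetT cardsT card_ord hu leqnn.
  apply: (on_top (Bs _ _) (k := Ordinal g_gt0) _ Yw _ hu ha); last by rewrite uT inE.
  by move=> l _; left; rewrite uT inE.
move=> qg; have := IH _ (ltnW qg); rewrite subnS.
have: (0 < g - q)%N by rewrite subn_gt0.
have: (g - q <= g)%N by rewrite leq_subr.
case: (g - q)%N => // p /= pg _ {}IH Vw Yw Tw Ew.
have rp : r - p.+1%:Z = r - p%:Z - 1 by rewrite intS opprD addrCA addrC.
have rp1 : r - p.+1%:Z + 1 = r - p%:Z by rewrite rp subrK.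
have [w' [Vw' Yw' Tw']] : exists v, [/\ on (V p.+1 (r - p%:Z - 1)) p.+1 n.+1 v,
    on (B p.+1 (r - p%:Z - 1)) p n.+2 (dY v) &
    on (B p.+1 (r - p%:Z)) p n.+1 (dT a v - fmap D w)].
  apply: local_exact => //.
  - by apply: on_fmap Vw; apply: V_D.
  - by rewrite -fmap_dY; apply: onm_fmap Yw; apply: B_D.
  - by move=> p0; rewrite p0 subr0; apply: Ew.
have DDw z : fmap D (fmap D z) = 0 :> form.
  by apply: fcoefP => u al; rewrite /fmap DD.
have fD0 : fmap D 0 = 0 :> form by apply: fcoefP => u al; rewrite /fmap linear0.
have TDw' : on (B p.+2 (r - p%:Z)) p n.+1 (dT a (fmap D w')).
  rewrite -fmap_dT -[fmap D (dT a w')]subr0 -(DDw w) -fmapB.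
  by apply: on_fmap Tw'; apply: B_D.
have [v' [y' []]] : exists v y, [/\ on (V p.+1 (r - p.+1%:Z - 1)) p.+2 n.+1 v,
    on (B p.+1 (r - p.+1%:Z - 1)) p.+1 n.+2 (dY v),
    on (V p (r - p.+1%:Z)) p.+1 n.+1 y, onm (B p (r - p.+1%:Z)) p.+1 n.+2 (dY y) &
    on (B p.+1 (r - p.+1%:Z)) p.+1 n.+1 (w' - dT a v - fmap D y)].
  by apply: IH => //; rewrite ?rp1 ?rp // -?rp; apply/onmS; rewrite ?rp.
rewrite !rp => _ _ Vy' /onmS Yy' Hy'.
(* Modulo [B], [w' = dT v' + D y'] and [dT w' = D w], so subtracting [dT y'] makes [D w0] vanish. *)
pose w0 := w - dT a y'.
have Ba : forall k x, B p (r - p%:Z - 1) x -> B p (r - p%:Z) (a k *: x).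
  by move=> k x /(B_a k); rewrite subrK.
have Va : forall k x, V p (r - p%:Z - 1) x -> V p (r - p%:Z) (a k *: x).
  by move=> k x /(V_a k); rewrite subrK.
have Vw0 : on (V p (r - p%:Z)) p n.+1 w0.
  by apply: onB => //; apply/onmS; apply: onm_dT Vy'.
have Yw0 : onm (B p (r - p%:Z)) p n.+2 (dY w0).
  rewrite linearB /= dY_dT opprK; apply: onmD => //.
  by apply: onm_dT Yy'.
have Dw0 : on (B p.+1 (r - p%:Z)) p n.+1 (fmap D w0).
  have -> : fmap D w0 = dT a (w' - dT a v' - fmap D y') - (dT a w' - fmap D w).
    rewrite [dT a (_ - _ - _)]linearB /= [dT a (_ - _)]linearB /= dT_dT subr0.
    by rewrite fmapB fmap_dT opprB [RHS]addrC subrKA.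
  apply: onB => //; apply/onmS; apply: onm_dT Hy' => // k x /(B_a k).
  by rewrite subrK.
(* Primitives are chosen for the coefficients of [hY w0] instead of [w0]: as [w0 = dY (hY w0)], the
   form [dY y0] is then a primitive of [w0] that is still a [dY]-cycle. *)
have [y0 Hy0] : exists y0 : form, forall (u : {set 'I_g}) (al : {ffun 'I_g -> nat}), #|u| = p.+1 -> mdeg al = n ->
    V p.-1 (r - p%:Z) (y0 u al) /\ B p (r - p%:Z) (hY w0 u al - D (y0 u al)).
  have ch (c : {set 'I_g} * {ffun 'I_g -> nat}) : exists y, #|c.1| = p.+1 -> mdeg c.2 = n ->
      V p.-1 (r - p%:Z) y /\ B p (r - p%:Z) (hY w0 c.1 c.2 - D y).
    have [[cu ca]|nc] := pselect (#|c.1| = p.+1 /\ mdeg c.2 = n); last first.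
      by exists 0 => cu ca; case: nc.
    have [||y Hy] := @acyclic p (hY w0 c.1 c.2) pg.
    - by apply: (on_hY _ _ cu ca) => //; apply/onmS.
    - by have := on_hY (Bs _ _) (iffRL (onmS _ _ _ _) Dw0) cu ca; rewrite -fmap_hY.
    by exists y.
  have [f Hf] := choice ch.
  by exists (fun u al => f (u, al)) => u al; apply: (Hf (u, al)).
exists y', (dY y0); split=> //.
- by apply/onmS; apply: onm_dY => // u al hu ha; have [] := Hy0 u al hu ha.
- by rewrite dY_dY => u al _ _; have [] := Bs p.-1 (r - p%:Z).
rewrite -/w0 fmap_dY -[w0](subrK (dY (hY w0))) -addrA; apply: onD => //.
  exact: homotopy_on.
rewrite -linearB; apply/onmS; apply: onm_dY => // u al hu ha.
by have [] := Hy0 u al hu ha.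
Qed.

End Chase.

(** * Products and powers of ideals *)

Section Ideals.
Variable R : comNzRingType.
Implicit Types I J K : R -> Prop.

Lemma ideal_submod I : is_ideal I -> submod (X := R^o) I.
Proof. by case. Qed.

Lemma prod_ideal_mul I J x y : I x -> J y -> prod_ideal I J (x * y).
Proof.
move=> Ix Jy; exists [:: (x, y)]; rewrite big_seq1; split=> // p.
by rewrite inE => /eqP->.
Qed.

Lemma prod_ideal_add I J x y :
  prod_ideal I J x -> prod_ideal I J y -> prod_ideal I J (x + y).
Proof.
move=> [s [sP ->]] [t [tP ->]]; exists (s ++ t); rewrite big_cat; split=> // p.
by rewrite mem_cat => /orP[/sP|/tP].
Qed.

Lemma prod_ideal_zero I J : prod_ideal I J 0.
Proof. by exists [::]; rewrite big_nil; split. Qed.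

Lemma prod_ideal_sub I J K : is_ideal K ->
  (forall x y, I x -> J y -> K (x * y)) -> subI (prod_ideal I J) K.
Proof.
move=> [K0 KD _] H x [s [sP ->]]; rewrite big_seq.
by apply: big_ind => // p /sP[]; apply: H.
Qed.

Lemma prod_ideal_is_ideal I J : is_ideal I -> is_ideal (prod_ideal I J).
Proof.
move=> [_ _ IM]; split.
- exact: prod_ideal_zero.
- by move=> x y; apply: prod_ideal_add.
move=> c x [s [sP ->]]; rewrite mulr_sumr big_seq.
apply: big_ind => [|y z|p /sP[Ip Jp]].
- exact: prod_ideal_zero.
- exact: prod_ideal_add.
by rewrite mulrA; apply: prod_ideal_mul => //; apply: IM.
Qed.

Lemma ideal_pow_is_ideal I n : is_ideal (ideal_pow I n).
Proof. by elim: n => [|n IH] //=; apply: prod_ideal_is_ideal. Qed.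

Lemma mem_gen_ideal (s : seq R) i : (i < size s)%N -> gen_ideal s s`_i.
Proof.
move=> si; exists (mkseq (fun l => (l == i)%:R) (size s)); rewrite size_mkseq; split=> //.
rewrite (bigD1 (Ordinal si)) //= nth_mkseq // eqxx mul1r big1 ?addr0 // => l li.
by rewrite nth_mkseq // (_ : _ == _ = false) ?mul0r //; apply/negbTE.
Qed.

End Ideals.

(** * Filtrations and the Cech complex of the quotient by the Rees algebra *)

Section Filtration.
Variables (R : comNzRingType) (a : seq R) (F : int -> R -> Prop).
Hypothesis filF : I_filtration (gen_ideal a) F.

Lemma fil_submod n : submod (X := R^o) (F n).
Proof. by apply: ideal_submod; case: filF. Qed.

Lemma filD n x y : F n x -> F n y -> F n (x + y).
Proof. by have [_ H _] := fil_submod n; apply: H. Qed.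

Lemma filB n x y : F n x -> F n y -> F n (x - y).
Proof. by move=> Fx Fy; apply: (submodB (fil_submod n)). Qed.

Lemma filM n x y : F n x -> F n (y * x).
Proof. by have [_ _ H] := fil_submod n; apply: H. Qed.

Lemma fil_sum n (I : Type) (s : seq I) (Q : pred I) (f : I -> R) :
  (forall i, Q i -> F n (f i)) -> F n (\sum_(i <- s | Q i) f i).
Proof. by have [F0 FD _] := fil_submod n; apply: big_ind. Qed.

Lemma fil_anti m n x : m <= n -> F n x -> F m x.
Proof.
have [_ F0 FS _ _] := filF.
case: (lerP m 0) => [m0 _ _|m0]; first exact: F0.
case: m m0 => // m _; case: n => // n; rewrite lez_nat => mn.
by rewrite -(subnK mn); elim: (n - m)%N => //= k IH /FS.
Qed.

Lemma fil_mul m n x y : F m x -> F n y -> F (m + n) (x * y).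
Proof.
have [_ F0 _ FM _] := filF.
case: m => [m|m] Fx; last by move=> Fy; apply: filM; apply: fil_anti Fy; lia.
case: n => [n|n] Fy; first by apply: FM; apply: prod_ideal_mul.
by rewrite mulrC; apply: filM; apply: fil_anti Fx; lia.
Qed.

Lemma fil_exp n x k : F n x -> F (k%:Z * n) (x ^+ k).
Proof.
have [_ F0 _ _ _] := filF; move=> Fx; elim: k => [|k IH]; first by apply: F0; lia.
by rewrite exprS (_ : _ * _ = n + k%:Z * n); [apply: fil_mul | lia].
Qed.

Lemma fil_pow n x : ideal_pow (gen_ideal a) n x -> F n%:Z x.
Proof. by case: filF => _ _ _ _ H; apply: H. Qed.

Lemma fil_gen (k : 'I_(size a).+1) : k != ord0 -> F 1 (cech_gen k).
Proof.
move=> k0; apply: (@fil_pow 1); rewrite /cech_gen -[_ == _ :> nat](_ : (k == ord0) = _) //.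
rewrite (negPf k0) -[_`_ _]mul1r; apply: prod_ideal_mul => //.
apply: mem_gen_ideal; case: k k0 => -[|k] //= kl; rewrite -?val_eqE //=.
Qed.

Local Notation csets := {set 'I_(size a).+1}.

Lemma fil_cech_b (S : csets) : ord0 \notin S -> F #|S|%:Z (cech_b S).
Proof.
move=> S0; rewrite /cech_b -sum1_card.
have [_ F0 _ _ _] := filF.
elim/big_rec2: _ => [|k m x kS Fx]; first exact: F0.
rewrite addnC PoszD mulrC; apply: fil_mul => //; apply: fil_gen.
by apply: contraNneq S0 => <-.
Qed.

Lemma cech_b1 (S : csets) k : k \in S -> cech_b S = cech_gen k * cech_b (S :\ k).
Proof. by move=> kS; rewrite /cech_b (big_setD1 k). Qed.

Lemma cech_gen0 : cech_gen (a := a) ord0 = 1.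
Proof. by []. Qed.

Lemma cech_b0 (S : csets) : ord0 \notin S -> cech_b (ord0 |: S) = cech_b S.
Proof. by move=> S0; rewrite (@cech_b1 _ ord0) ?setU11 // setU1K // cech_gen0 mul1r. Qed.

Lemma cech_e_card (S : csets) : ord0 \notin S -> cech_e S = #|S|%:Z.
Proof.
move=> S0; rewrite /cech_e (eq_bigr (fun=> 1)); last first.
  move=> k kS; rewrite /cech_deg; case: eqP => // k0.
  by move: kS; rewrite (_ : k = ord0) ?(negPf S0) //; apply: val_inj.
by rewrite sumr_const -[RHS]natz.
Qed.

Lemma cech_e0 (S : csets) : ord0 \notin S -> cech_e (ord0 |: S) = #|S|%:Z - 1.
Proof.
by move=> S0; rewrite /cech_e big_setU1 //= -/(cech_e S) cech_e_card // addrC.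
Qed.

Lemma cech_d_sgn N (c : csets -> R) T :
  cech_d N c T = \sum_(k in T) sgn R k T * c (T :\ k) * cech_gen k ^+ N.
Proof. by []. Qed.

(** The index of [t^-1] is the least one and its coefficient is 1, so it contributes [c S] with sign
    [+] and flips every other sign: the full Cech complex is a mapping cone of the complex on the
    [a_k t]. *)
Lemma cech_d0 N (c : csets -> R) (S : csets) : ord0 \notin S ->
  cech_d N c (ord0 |: S) = c S - cech_d N (fun S' => c (ord0 |: S')) S.
Proof.
move=> S0; rewrite !cech_d_sgn big_setU1 //= setU1K // cech_gen0 expr1n mulr1.
rewrite sgn_first ?mul1r -?sumrN; last by move=> l; rewrite ltn0.
congr (_ + _); apply: eq_bigr => k kS.
have k0 : k != ord0 by apply: contraNneq S0 => <-.
rewrite sgnU1 // lt0n [_ == _ :> nat](_ : _ = (k == ord0)) // k0 mulN1r !mulNr.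
congr (- (_ * c _ * _)).
by apply/setP=> x; rewrite !inE; case: (eqVneq x ord0) => [->|//]; rewrite eq_sym k0.
Qed.

Lemma cech_dd N (c : csets -> R) T : cech_d N (cech_d N c) T = 0.
Proof.
pose f k l := if [&& k \in T, l \in T & l != k] then
  (sgn R k T * sgn R l (T :\ k) * c (T :\ k :\ l)) * (cech_gen k ^+ N * cech_gen l ^+ N) else 0.
rewrite -[RHS](antisym_sum0 (f := f)).
- rewrite cech_d_sgn big_mkcond; apply: eq_bigr => k _; rewrite /f.
  case: (k \in T) => /=; last by rewrite big1.
  rewrite cech_d_sgn mulr_sumr mulr_suml big_mkcond; apply: eq_bigr => l _.
  rewrite !inE andbC; case: ifP => // _; ring.
- by move=> k; rewrite /f eqxx !andbF.
move=> k l; rewrite /f (eq_sym k l) [X in (if X then _ else _) = _]andbCA.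
case: ifP => [/and3P[lT kT lk]|_]; last by rewrite oppr0.
rewrite (sgnD1 R k lT) (sgnD1 R l kT) (sgn_swap R lk) setDDl setUC -setDDl; ring.
Qed.

Lemma eq_cech_d N (c c' : csets -> R) (T : csets) :
  (forall k, k \in T -> c (T :\ k) = c' (T :\ k)) -> cech_d N c T = cech_d N c' T.
Proof. by move=> H; rewrite !cech_d_sgn; apply: eq_bigr => k /H->. Qed.

Lemma ev_and (P Q : nat -> Prop) :
  (exists L0, forall L, (L0 <= L)%N -> P L) -> (exists L0, forall L, (L0 <= L)%N -> Q L) ->
  exists L0, forall L, (L0 <= L)%N -> P L /\ Q L.
Proof.
move=> [L1 H1] [L2 H2]; exists (maxn L1 L2) => L; rewrite geq_max => /andP[h1 h2].
by split; [apply: H1|apply: H2].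
Qed.

(* For [S] avoiding the index of [t^-1], the sequence [L |-> x S L] stands for
   the fraction [x S L t^(j + L |S|) / x_S^L] (any large [L]) of the localization
   of [(+)_n R / I_n] at [x_S]. *)
Local Notation cochains := (csets -> nat -> R^o).
Implicit Types x y : cochains.

Definition germ (i : nat) (j : int) x := exists L0, forall L, (L0 <= L)%N ->
  forall S : csets, ord0 \notin S -> #|S| = i ->
    F (j + L.+1%:Z * i%:Z) (cech_b S * x S L - x S L.+1).
Definition null (i : nat) (j : int) x := exists L0, forall L, (L0 <= L)%N ->
  forall S : csets, ord0 \notin S -> #|S| = i -> F (j + L%:Z * i%:Z) (x S L).

Definition cech_D x : cochains := fun S L => cech_d L (fun S' => x S' L) S.
(** Division by [a_k t] on the components whose chosen index is [k], and 0 elsewhere, so that the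
    sum of [a_k] times these operators is the identity. Since [1 / a_k = b_(S \ k) / b_S], the
    denominator gains one factor and the numerator comes from level [L.-1]. *)
Definition cech_div (k : 'I_(size a)) x : cochains := fun S L =>
  if [pick l in S] == Some (lift ord0 k) then cech_b (S :\ lift ord0 k) * x S L.-1 else 0.

Lemma cochainP x y : (forall S L, x S L = y S L) -> x = y.
Proof. by move=> H; apply: funext => S; apply: funext => L. Qed.

Fact cech_D_linear : linear cech_D.
Proof.
move=> c x y; apply: cochainP => S L.
change (cech_d L (fun S' => c * x S' L + y S' L) S =
  c * cech_d L (fun S' => x S' L) S + cech_d L (fun S' => y S' L) S).
rewrite !cech_d_sgn mulr_sumr -big_split; apply: eq_bigr => k _ /=; ring.
Qed.
HB.instance Definition _ := GRing.isLinear.Build R cochains cochains *:%R cech_D cech_D_linear.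

Fact cech_div_linear k : linear (cech_div k).
Proof.
move=> c x y; apply: cochainP => S L.
change (cech_div k (c *: x + y) S L = c * cech_div k x S L + cech_div k y S L).
rewrite /cech_div; case: ifP => _; last by rewrite mulr0 addr0.
change (cech_b (S :\ lift ord0 k) * (c * x S L.-1 + y S L.-1) =
  c * (cech_b (S :\ lift ord0 k) * x S L.-1) + cech_b (S :\ lift ord0 k) * y S L.-1); ring.
Qed.
HB.instance Definition _ k :=
  GRing.isLinear.Build R cochains cochains *:%R (cech_div k) (cech_div_linear k).

Lemma germ_submod i j : submod (germ i j).
Proof.
split.
- exists 0%N => L _ S _ _; rewrite mulr0 subr0; by have [] := fil_submod (j + L.+1%:Z * i%:Z).
- move=> x y /ev_and H /H[L0 {}H]; exists L0 => L hL S S0 Si.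
  have [/(_ S S0 Si) Hx /(_ S S0 Si) Hy] := H L hL.
  have [_ FD _] := fil_submod (j + L.+1%:Z * i%:Z).
  have := FD _ _ Hx Hy; congr (F _ _).
  change ((cech_b S * x S L - x S L.+1) + (cech_b S * y S L - y S L.+1) =
    cech_b S * (x S L + y S L) - (x S L.+1 + y S L.+1)); ring.
move=> c x [L0 H]; exists L0 => L hL S S0 Si.
have := filM c (H L hL S S0 Si); congr (F _ _).
change (c * (cech_b S * x S L - x S L.+1) = cech_b S * (c * x S L) - c * x S L.+1); ring.
Qed.

Lemma null_submod i j : submod (null i j).
Proof.
split.
- exists 0%N => L _ S _ _; by have [] := fil_submod (j + L%:Z * i%:Z).
- move=> x y /ev_and H /H[L0 {}H]; exists L0 => L hL S S0 Si.
  have [/(_ S S0 Si) Hx /(_ S S0 Si) Hy] := H L hL.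
  by have [_ FD _] := fil_submod (j + L%:Z * i%:Z); apply: FD.
move=> c x [L0 H]; exists L0 => L hL S S0 Si.
exact: filM c (H L hL S S0 Si).
Qed.

Lemma fil_nth (k : 'I_(size a)) : F 1 a`_k.
Proof. exact: (@fil_gen (lift ord0 k)). Qed.

Lemma germ_scale i j (k : 'I_(size a)) x : germ i j x -> germ i (j + 1) (a`_k *: x).
Proof.
move=> [L0 H]; exists L0 => L hL S S0 Si.
have := fil_mul (fil_nth k) (H L hL S S0 Si); rewrite addrCA addrA; congr (F _ _).
change (a`_k * (cech_b S * x S L - x S L.+1) = cech_b S * (a`_k * x S L) - a`_k * x S L.+1); ring.
Qed.

Lemma null_scale i j (k : 'I_(size a)) x : null i j x -> null i (j + 1) (a`_k *: x).
Proof.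
move=> [L0 H]; exists L0 => L hL S S0 Si.
by have := fil_mul (fil_nth k) (H L hL S S0 Si); rewrite addrCA addrA.
Qed.

Lemma fil_cech_bD1 (S : csets) k i : k \in S -> ord0 \notin S -> #|S| = i ->
  F (i%:Z - 1) (cech_b (S :\ k)).
Proof.
move=> kS S0 <-; rewrite (cardsD1 k S) kS intS addrC addKr.
by apply: fil_cech_b; rewrite !inE negb_and S0 orbT.
Qed.

Lemma germ_div i j k x : germ i j x -> germ i (j - 1) (cech_div k x).
Proof.
move=> [L0 H]; exists L0.+1 => -[//|L] hL S S0 Si; rewrite /cech_div.
case: pickP => [l lS|_]; last by rewrite /= mulr0 subr0; have [] := fil_submod (j - 1 + L.+2%:Z * i%:Z).
case: eqP => [[lk]|_]; last by rewrite mulr0 subr0; have [] := fil_submod (j - 1 + L.+2%:Z * i%:Z).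
have := fil_mul (fil_cech_bD1 lS S0 Si) (H L hL S S0 Si); congr (F _ _); first lia.
by rewrite -lk /=; ring.
Qed.

Lemma null_div i j k x : null i j x -> null i (j - 1) (cech_div k x).
Proof.
move=> [L0 H]; exists L0.+1 => -[//|L] hL S S0 Si; rewrite /cech_div.
case: pickP => [l lS|_]; last by have [] := fil_submod (j - 1 + L.+1%:Z * i%:Z).
case: eqP => [[lk]|_]; last by have [] := fil_submod (j - 1 + L.+1%:Z * i%:Z).
have := fil_mul (fil_cech_bD1 lS S0 Si) (H L hL S S0 Si); congr (F _ _); first lia.
by rewrite -lk.
Qed.

Lemma cech_div_sum i j x : germ i.+1 j x ->
  null i.+1 j (\sum_(k < size a) a`_k *: cech_div k x - x).
Proof.
move=> [L0 H]; exists L0.+1 => -[//|L] hL S S0 Si.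
have := H L hL S S0 Si; congr (F _ _).
change (cech_b S * x S L - x S L.+1 = (\sum_(k < size a) a`_k *: cech_div k x) S L.+1 - x S L.+1).
congr (_ - _); rewrite !fct_sumE.
change (cech_b S * x S L = \sum_(k < size a) a`_k * cech_div k x S L.+1).
rewrite /cech_div; case: pickP => [l lS|S00]; last first.
  by move: Si; rewrite (eq_card0 S00).
case: (unliftP ord0 l) lS => [k ->|->]; last by rewrite (negPf S0).
move=> kS; rewrite (bigD1 k) //= eqxx big1 ?addr0 => [|l' lk].
  by rewrite (cech_b1 kS) mulrA.
case: eqP => [e|_]; last by rewrite mulr0.
by case: e lk => kl; case/eqP; apply: val_inj; rewrite /= -[RHS]add0n kl.
Qed.

Lemma cech_DD x : cech_D (cech_D x) = 0.
Proof. by apply: cochainP => S L; apply: cech_dd. Qed.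

Lemma germ_D i j x : germ i j x -> germ i.+1 j (cech_D x).
Proof.
move=> [L0 H]; exists L0 => L hL S S0 Si.
have -> : cech_b S * cech_D x S L - cech_D x S L.+1 = \sum_(k in S) sgn R k S *
    (cech_gen k ^+ L.+1 * (cech_b (S :\ k) * x (S :\ k) L - x (S :\ k) L.+1)).
  rewrite /cech_D !cech_d_sgn mulr_sumr -sumrB; apply: eq_bigr => k kS.
  by rewrite (cech_b1 kS) exprS; ring.
apply: fil_sum => k kS; apply: filM.
have S0' : ord0 \notin S :\ k by rewrite !inE negb_and S0 orbT.
have k0 : k != ord0 by apply: contraNneq S0 => <-.
have Si' : #|S :\ k| = i by move: Si; rewrite (cardsD1 k) kS => -[].
have := fil_mul (fil_exp L.+1 (fil_gen k0)) (H L hL _ S0' Si').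
by congr (F _ _); lia.
Qed.

Lemma null_D i j x : null i j x -> null i.+1 j (cech_D x).
Proof.
move=> [L0 H]; exists L0 => L hL S S0 Si; rewrite /cech_D cech_d_sgn.
apply: fil_sum => k kS.
have S0' : ord0 \notin S :\ k by rewrite !inE negb_and S0 orbT.
have k0 : k != ord0 by apply: contraNneq S0 => <-.
have Si' : #|S :\ k| = i by move: Si; rewrite (cardsD1 k) kS => -[].
rewrite -mulrA; apply: filM.
have := fil_mul (fil_exp L (fil_gen k0)) (H L hL _ S0' Si').
by congr (F _ _); [lia | rewrite mulrC].
Qed.

Lemma germ_iter i j x L0 (S : csets) : ord0 \notin S -> #|S| = i ->
  (forall L, (L0 <= L)%N -> F (j + L.+1%:Z * i%:Z) (cech_b S * x S L - x S L.+1)) ->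
  forall L m, (L0 <= L)%N ->
    F (j + (L + m)%:Z * i%:Z) (cech_b S ^+ m * x S L - x S (L + m)%N).
Proof.
move=> S0 Si H L m hL; elim: m => [|m IH].
  by rewrite mul1r addn0 subrr; have [] := fil_submod (j + L%:Z * i%:Z).
have FS := fil_cech_b S0; rewrite Si in FS.
have -> : cech_b S ^+ m.+1 * x S L - x S (L + m.+1)%N =
    cech_b S * (cech_b S ^+ m * x S L - x S (L + m)%N) +
    (cech_b S * x S (L + m)%N - x S (L + m.+1)%N) by rewrite exprS; ring.
apply: filD; first by have := fil_mul FS IH; congr (F _ _); lia.
by rewrite addnS; apply: H; lia.
Qed.

(* The connecting map of [0 -> R'(F) -> R[t, t^-1] -> (+)_n R / I_n -> 0], whose
   middle term is acyclic because [t^-1] is invertible on it. *)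
Lemma germ_acyclic i j x : loc_coh_vanish F a i.+1 j ->
  germ i j x -> null i.+1 j (cech_D x) ->
  exists y, germ i.-1 j y /\ null i j (x - cech_D y).
Proof.
move=> vanish Gx Nx; have [L0 H] := ev_and Gx Nx.
have iterx (S : csets) : ord0 \notin S -> #|S| = i -> forall L m, (L0 <= L)%N ->
    F (j + (L + m)%:Z * i%:Z) (cech_b S ^+ m * x S L - x S (L + m)%N).
  by move=> S0 Si; apply: (germ_iter S0 Si) => L /H[/(_ S S0 Si)].
(* A set containing [ord0] has Cech weight [i - 1] only, so [x S N] must lie in degree
   [j + N (i - 1)]; this [m] puts [b_S^m] there. *)
pose m := (`|j| + L0 * i)%N; pose N := (L0 + m)%N.
have xF (S : csets) : ord0 \notin S -> #|S| = i -> F (j + N%:Z * (i%:Z - 1)) (x S N).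
  move=> S0 Si; rewrite -[x S N](subKr (cech_b S ^+ m * x S L0)); apply: filB.
    rewrite [_ ^+ m * _]mulrC; apply: filM.
    have := fil_exp m (fil_cech_b S0); rewrite Si => Fb; apply: fil_anti Fb.
    by rewrite /N /m; nia.
  by have := iterx S S0 Si L0 m (leqnn _) => Fi; apply: fil_anti Fi; rewrite -/N; nia.
(* By [cech_d0], [c] is the full Cech differential of the cochain over [R[t, t^-1]] equal to [x] on
   sets avoiding [ord0] and to 0 on the others; hence it is a cocycle exactly. *)
pose c (S : csets) : R := if ord0 \in S then x (S :\ ord0) N else cech_D x S N.
have c0 (S : csets) : ord0 \notin S -> c (ord0 |: S) = x S N.
  by move=> S0; rewrite /c setU11 setU1K.
have c1 (S : csets) : ord0 \notin S -> c S = cech_D x S N.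
  by move=> S0; rewrite /c (negPf S0).
have notD (S : csets) k : ord0 \notin S -> ord0 \notin S :\ k.
  by move=> S0; rewrite !inE negb_and S0 orbT.
have [||N' [c' [Vc' Hc']]] := vanish N c.
- move=> S Si; case: (boolP (ord0 \in S)) => S0.
    have Si' : #|S :\ ord0| = i by move: Si; rewrite (cardsD1 ord0) S0 => -[].
    rewrite -(setD1K S0) cech_e0 ?setD11 // c0 ?setD11 // Si'.
    by apply: xF; rewrite ?setD11.
  rewrite cech_e_card // Si c1 //.
  have [_ /(_ S S0 Si)] := H N (leq_addr _ _); exact.
- move=> T _; exists 0%N; rewrite expr0 mul1r.
  case: (boolP (ord0 \in T)) => T0.
    rewrite -(setD1K T0) cech_d0 ?setD11 // c1 ?setD11 //.
    rewrite (@eq_cech_d _ _ (fun S' => x S' N)) ?subrr // => k _.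
    by rewrite c0 //; apply: notD; rewrite setD11.
  rewrite (@eq_cech_d _ _ (cech_d N (fun S => x S N))) ?cech_dd // => k _.
  by rewrite c1 //; apply: notD.
pose dl (S : csets) := cech_d N' (fun S' => c' (ord0 |: S')) S.
have /choice[f Hf] (S : csets) : exists n, ord0 \notin S -> #|S| = i ->
    cech_b S ^+ n * (cech_b S ^+ N' * x S N - cech_b S ^+ N * (c' S - dl S)) = 0.
  have [[S0 Si]|nS] := pselect (ord0 \notin S /\ #|S| = i); last first.
    by exists 0%N => S0 Si; case: nS.
  have [|L HL] := Hc' (ord0 |: S); first by rewrite cardsU1 S0 Si.
  by exists L => _ _; move: HL; rewrite cech_b0 // c0 // cech_d0.
(* On [ord0 |: S] the coboundary equation reads [x S = c' S - dl S] as fractions. As [c' S] has its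
   numerator in the filtration, [x] agrees with [- dl], the differential of [- c' (ord0 |: _)]; the
   power of [cech_b S] passes from denominator exponent [N'] to [L]. *)
pose y : cochains := fun S L => - (cech_b S ^+ (L - N') * c' (ord0 |: S)).
exists y; split.
  exists N' => L hL S _ _; rewrite /y subSn // exprS.
  rewrite (_ : _ - _ = 0); first by have [] := fil_submod (j + L.+1%:Z * i.-1%:Z).
  ring.
(* The sum bounds all the annihilating exponents [f S] at once. *)
exists (N + N' + \sum_(S : csets) f S)%N => L hL S S0 Si.
have Dy : cech_D y S L = - (cech_b S ^+ (L - N') * dl S).
  rewrite /cech_D /dl !cech_d_sgn mulr_sumr -sumrN; apply: eq_bigr => k kS.
  rewrite /y (cech_b1 kS) exprMn.
  have {2}-> : L = ((L - N') + N')%N by lia.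
  rewrite exprD; ring.
have [q Lq] : exists q, L = (N + N' + f S + q)%N.
  exists (L - (N + N' + f S))%N; move: hL; rewrite (bigD1 S) //=; lia.
have E : cech_b S ^+ (L - N) * x S N = cech_b S ^+ (L - N') * (c' S - dl S).
  have := Hf S S0 Si; move/(congr1 (fun z => cech_b S ^+ q * z)); rewrite mulr0.
  have -> : (L - N = q + f S + N')%N by lia.
  have -> : (L - N' = q + f S + N)%N by lia.
  by rewrite !exprD => e; apply/eqP; rewrite -subr_eq0 -e; apply/eqP; ring.
change (F (j + L%:Z * i%:Z) (x S L - cech_D y S L)); rewrite Dy.
have -> : x S L - - (cech_b S ^+ (L - N') * dl S) =
    cech_b S ^+ (L - N') * c' S - (cech_b S ^+ (L - N) * x S N - x S L).
  by rewrite E; ring.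
apply: filB; last first.
  have := iterx S S0 Si N (L - N)%N (leq_addr _ _).
  by rewrite subnKC //; lia.
have := Vc' S Si; rewrite cech_e_card // Si => Fc.
have := fil_mul (fil_exp (L - N') (fil_cech_b S0)) Fc; rewrite Si; congr (F _ _).
by rewrite Lq; nia.
Qed.

End Filtration.

(** * Evaluation of the [Y_k] at the [a_k] *)

Section Evaluation.
Variables (R : comNzRingType) (g : nat) (X : lmodType R) (a : 'I_g -> R).
Local Notation form := ({set 'I_g} -> {ffun 'I_g -> nat} -> X).
Implicit Types w z : form.

HB.instance Definition _ n := GRing.isLinear.Build R form X *:%R (eps a n) (eps_linear a n).

Lemma eps_eq0 n w : (forall al, w set0 al = 0) -> eps a n w = 0.
Proof.
elim: n w => [|n IH] w w0; first exact: w0.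
apply: IH => al; rewrite dTE big1 // => k _; rewrite /iota_ inE /hY.
rewrite big1 ?scaler0 // => l /firstP[].
by rewrite !inE orbF => /eqP-> _; rewrite setU0 setDv w0.
Qed.

(** [dT] reads coefficients at sets [k |: u] only, where the homotopy formula has no exception. *)
Lemma dT_hY_dY z : dT a (hY (dY z)) = dT a z + dY (dT a (hY z)).
Proof.
apply: fcoefP => u al; rewrite dY_dT -[_ - _](linearB (dT a)) /= !dTE; apply: eq_bigr => k _.
rewrite /iota_; case: ifP => // _; rewrite fcoefB -(@homotopyY _ _ _ z).
  by rewrite addrAC subrr add0r.
by exists k; rewrite setU11.
Qed.

(** By [dT_hY_dY] the error term is [dY (dT (hY z))], which by induction evaluates through
    [dT (dT _) = 0]. *)
Lemma eps_dY n z : eps a n.+1 (dY z) = eps a n (dT a z).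
Proof.
elim: n z => [|n IH] z; rewrite [LHS]/= dT_hY_dY.
  by rewrite fcoefD dYE big1 ?addr0 // => k _; rewrite /mulY ffunE.
by rewrite -[LHS]/(eps a n.+1 _) linearD /= -[X in _ + X]/(eps a n.+1 _) IH dT_dT linear0 addr0.
Qed.

(** [mulY k w] is [dY (ext k w)] up to a multiple of [e_k], and [eps] sees only exterior degree
    0. *)
Lemma eps_mulY n k w : eps a n.+1 (mulY k w) = a k *: eps a n w.
Proof.
have ext0 m z : eps a m (ext k z) = 0.
  by apply: eps_eq0 => al; rewrite /ext inE.
rewrite -[mulY k w](subrK (ext k (dY w))) -dY_ext.
transitivity (eps a n.+1 (dY (ext k w)) + eps a n.+1 (ext k (dY w))); first exact: linearD.
by rewrite ext0 addr0 eps_dY dT_ext linearB linearZ /= ext0 subr0.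
Qed.

End Evaluation.

(** * From the double complex to the intersection formula *)

Section Conclusion.
Variables (R : comNzRingType) (a : seq R) (F : int -> R -> Prop).
Hypothesis filF : I_filtration (gen_ideal a) F.
Local Notation g := (size a).
Local Notation I := (gen_ideal a).
Local Notation form := ({set 'I_g} -> {ffun 'I_g -> nat} -> R^o).
Local Notation cochains := ({set 'I_g.+1} -> nat -> R^o).
Local Notation aa := (fun k : 'I_g => a`_k).

Lemma eps_surj n x : ideal_pow I n x -> exists w : form, eps aa n w = x.
Proof.
elim: n x => [|n IH] x; first by exists (fun _ _ => x).
move=> [s [sP ->]]; rewrite big_seq.
apply: (@big_ind _ (fun z => exists w : form, eps aa n.+1 w = z)).
- by exists 0; apply: linear0.
- by move=> _ _ [w1 <-] [w2 <-]; exists (w1 + w2); apply: linearD.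
move=> [_ _] /sP[/= /IH[w <-] [c [_ ->]]].
exists (\sum_(k < g) c`_k *: mulY k w).
transitivity (\sum_(k < g) eps aa n.+1 (c`_k *: mulY k w)); first exact: (linear_sum (eps aa n.+1)).
rewrite mulr_sumr; apply: eq_bigr => k _.
transitivity (c`_k *: eps aa n.+1 (mulY k w)); first exact: linearZ.
rewrite eps_mulY.
change (c`_k * (a`_k * eps aa n w) = eps aa n w * (c`_k * a`_k)); ring.
Qed.

(** Each step of [eps] multiplies coefficients by some [a_k], so the induction replaces [K] by
    [K I]. *)
Lemma eps_prod_ideal (K : R -> Prop) n (w : form) : is_ideal K -> on (X := R^o) K 0 n w ->
  prod_ideal (ideal_pow I n) K (eps aa n w).
Proof.
elim: n K w => [|n IH] K w Ki Kw.
  rewrite -[eps _ _ _]mul1r; apply: prod_ideal_mul => //; apply: Kw; first exact: cards0.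
  by rewrite /mdeg big1 // => k _; rewrite ffunE.
have KIi := prod_ideal_is_ideal I Ki.
have: on (X := R^o) (prod_ideal K I) 0 n (dT aa (hY w)).
  apply/onmS; apply: (onm_dT (X := R^o) (P := K)) => [|k x Kx|].
  - exact: ideal_submod.
  - change (prod_ideal K I (a`_k * x)); rewrite mulrC; apply: prod_ideal_mul => //.
    exact: mem_gen_ideal.
  by apply: (on_hY (ideal_submod Ki)); apply/onmS.
move=> /(IH _ _ KIi); apply: prod_ideal_sub.
  exact/prod_ideal_is_ideal/ideal_pow_is_ideal.
move=> x _ Ix [s [sP ->]]; rewrite mulr_sumr big_seq.
apply: big_ind => [|y z|p /sP[Kp Ip]].
- exact: prod_ideal_zero.
- exact: prod_ideal_add.
by rewrite [p.1 * _]mulrC mulrA; apply: prod_ideal_mul => //; apply: prod_ideal_mul.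
Qed.

(** In column 0 only the empty set counts and [x_S = 1], so a constant sequence is an element of the
    quotient module itself. *)
Definition cst_cochain (x : R^o) : cochains := fun _ _ => x.
Fact cst_cochain_linear : linear cst_cochain.
Proof. by []. Qed.
HB.instance Definition _ := GRing.isLinear.Build R R^o cochains *:%R cst_cochain cst_cochain_linear.

Definition ev_cochain L (x : cochains) : R^o := x set0 L.
Fact ev_cochain_linear L : linear (ev_cochain L).
Proof. by []. Qed.
HB.instance Definition _ L := GRing.isLinear.Build R cochains R^o *:%R (ev_cochain L) (ev_cochain_linear L).

Lemma on_null0 p j n (w : {set 'I_g} -> {ffun 'I_g -> nat} -> cochains) :
  on (null F 0 j) p n w ->
  exists L0, forall L, (L0 <= L)%N -> on (X := R^o) (F j) p n (fmap (ev_cochain L) w).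
Proof.
move=> H.
(* Exponents of a monomial of degree [n] are at most [n], so finitely many coefficients matter and a
   common level [L0] exists. *)
pose T := ({set 'I_g} * {ffun 'I_g -> 'I_n.+1})%type.
pose al (t : T) : {ffun 'I_g -> nat} := [ffun k => t.2 k : nat].
have /choice[f Hf] (t : T) : exists L0, #|t.1| = p -> mdeg (al t) = n ->
    forall L, (L0 <= L)%N -> F j (w t.1 (al t) set0 L).
  have [[tu ta]|nt] := pselect (#|t.1| = p /\ mdeg (al t) = n); last first.
    by exists 0%N => tu ta; case: nt.
  have [L0 HL] := H _ _ tu ta; exists L0 => _ _ L /HL/(_ set0).
  by rewrite inE cards0 mulr0 addr0; apply.
exists (\sum_t f t)%N => L hL u be hu hb.
have bn k : (be k < n.+1)%N by rewrite ltnS -hb /mdeg (bigD1 k) //= leq_addr.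
pose t : T := (u, [ffun k => Ordinal (bn k)]).
have alE : al t = be by apply/ffunP=> k; rewrite !ffunE.
have := Hf t hu; rewrite alE; apply=> //.
by apply: leq_trans hL; rewrite (bigD1 t) //= leq_addr.
Qed.

Lemma pow_cap_fil (r n : nat) x : (0 < g)%N -> (0 < r)%N ->
  (forall (i : nat) (j : int), i%:Z + j = r%:Z + 1 -> (i <= g)%N -> loc_coh_vanish F a i j) ->
  ideal_pow I n x -> F (n + r)%N%:Z x -> prod_ideal (ideal_pow I n) (F r%:Z) x.
Proof.
move=> g0 r0 vanish; case: n => [|n] Ix Fx.
  by rewrite -[x]mul1r; apply: prod_ideal_mul.
have [w ew] := eps_surj Ix.
pose W := fmap cst_cochain w.
pose D : {linear cochains -> cochains} := @cech_D R a.
pose sg k : {linear cochains -> cochains} := @cech_div R a k.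
have acyclic (i : nat) z : (i < g)%N -> germ F i (r%:Z - i%:Z) z ->
    null F i.+1 (r%:Z - i%:Z) (D z) ->
    exists y, germ F i.-1 (r%:Z - i%:Z) y /\ null F i (r%:Z - i%:Z) (z - D y).
  by move=> ig; apply: germ_acyclic => //; apply: vanish => //; lia.
(* The chase runs at [p = 0] on the constant cochain of [w]; its augmentation condition is where [x]
   in [F (n + r)] enters. *)
have [||||v [y []]] := @double_complex_chase R g cochains aa (germ F) (null F)
  D sg (germ_submod filF) (null_submod filF) (germ_scale filF)
  (null_scale filF) (germ_div filF) (null_div filF) (@cech_div_sum R a F)
  (@cech_DD R a) (germ_D filF) (null_D filF) r%:Z g0 acyclic n 0%N W isT.
- move=> u al _ _; exists 0%N => L _ S _ /eqP; rewrite cards_eq0 => /eqP->.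
  rewrite /cech_b big_set0 mul1r subrr.
  by have [] := fil_submod filF (r%:Z - 0%:Z + L.+1%:Z * 0%:Z).
- by [].
- by [].
- move=> _; rewrite !fmap_eps ew; apply: (null_D filF); exists 0%N => L _ S _ _.
  by move: Fx; congr (F _ _); lia.
rewrite !subr0 => _ Yv _ _ /on_null0[L1 H1]; have [L2 H2] := on_null0 Yv.
pose L := maxn L1 L2; pose vL := fmap (ev_cochain L) v.
have {H1} := H1 L (leq_maxl _ _); have {H2} := H2 L (leq_maxr _ _).
rewrite fmap_dY -/vL.
set f := fmap _ _ => Yv' Ff.
(* The differential of any cochain is an empty sum at [set0], so [y] drops out. *)
have Df : f = w - dT aa vL.
  rewrite /f !fmapB fmap_dT -/vL -[RHS]subr0; congr (_ - _).
  apply: fcoefP => u al; rewrite /fmap /ev_cochain.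
  change (cech_d L (fun S => y u al S L) set0 = 0).
  by rewrite cech_d_sgn big_set0.
(* [f] has coefficients in [F r], while those of [dY vL] lie only in [F (r - 1)] but in degree one
   higher; the extra factor from [I] moves them into [F r]. *)
have -> : x = eps aa n.+1 f + eps aa n.+2 (dY vL).
  rewrite eps_dY -ew -[w](subrK (dT aa vL)) -Df; exact (linearD (eps aa n.+1) f (dT aa vL)).
apply: prod_ideal_add; first by apply: eps_prod_ideal => //; case: filF.
have [Fi _ _ _ _] := filF; have := eps_prod_ideal (Fi _) Yv'.
have Pi : is_ideal (prod_ideal (ideal_pow I n.+1) (F r%:Z)).
  exact/prod_ideal_is_ideal/ideal_pow_is_ideal.
apply: prod_ideal_sub => // b z /= [s [sP ->]] Fz; rewrite mulr_suml big_seq.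
have [P0 PD _] := Pi; apply: big_ind => // p /sP[Ip1 Ip2].
rewrite -mulrA; apply: prod_ideal_mul => //.
have Fp : F 1 p.2.
  by apply: (@fil_pow _ _ _ filF 1); rewrite -[p.2]mul1r; apply: prod_ideal_mul.
by have := fil_mul filF Fp Fz; rewrite addrC subrK.
Qed.

End Conclusion.

Theorem theorem7p1 (R : comNzRingType) (m : R -> Prop) (d : nat)
    (a : seq R) (F : int -> R -> Prop) (r : nat) :
  cohen_macaulay_local m d ->
  regular_seq a ->
  height_eq (gen_ideal a) (size a) ->
  (1 <= size a)%N ->
  I_filtration (gen_ideal a) F ->
  I_admissible (gen_ideal a) F ->
  (1 <= r)%N ->
  (forall (i : nat) (j : int), i%:Z + j = r%:Z + 1 -> (i <= size a)%N ->
     loc_coh_vanish F a i j) ->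
  gr_depth_ge m F (size a).-1 ->
  forall (n : nat) (x : R),
    (ideal_pow (gen_ideal a) n x /\ F (n + r)%:Z x) <->
    prod_ideal (ideal_pow (gen_ideal a) n) (F r%:Z) x.
Proof.
move=> _ _ _ g0 filF _ r0 vanish _ n x; split=> [[Ix Fx]|Hx].
  exact: (pow_cap_fil filF).
have Ii := ideal_pow_is_ideal (gen_ideal a) n; split.
  by apply: prod_ideal_sub Hx => // b z Ib _; rewrite mulrC; case: Ii => _ _; apply.
apply: prod_ideal_sub Hx => [|b z /(fil_pow filF) Fb Fz]; first by case: filF.
exact (fil_mul filF Fb Fz).
Qed.
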